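(* Let $n \geq 2$ be an integer, let $A$ and $B$ be $C^*$-algebras, and let $\phi : A \to B$ be an involutive $n$-homomorphism. If $\phi$ is bounded, then $\phi$ is norm contractive, i.e. $\|\phi\| \leq 1$.
   Context: An $n$-homomorphism between algebras $A$ and $B$ is a linear map $\phi : A \to B$ with $\phi(a_1 a_2 \cdots a_n) = \phi(a_1)\phi(a_2)\cdots\phi(a_n)$ for all $a_1,\dots,a_n \in A$. It is involutive if $\phi(a^* ) = \phi(a)^*$ for all $a \in A$. The $C^*$-algebras are not assumed unital. *)

(* Defs.v *)
From HB Require Import structures.
From mathcomp Require Import all_boot all_order all_algebra.
From mathcomp Require Import complex.
From mathcomp Require Import all_classical all_reals all_analysis.

Set Implicit Arguments.
Unset Strict Implicit.
Unset Printing Implicit Defensive.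

Import Order.TTheory GRing.Theory Num.Theory.
Import numFieldNormedType.Exports.

Local Open Scope classical_set_scope.
Local Open Scope ring_scope.
Local Open Scope complex_scope.

(* MathComp's algebra structures all carry a unit element, so the possibly
   non-unital ones needed for C*-algebras are built here over lmodType. *)
HB.mixin Record Lmodule_isNonUnitalAlgebra (K : comNzRingType) A
    of GRing.Lmodule K A := {
  amul : A -> A -> A;
  amulA : associative amul;
  amulDl : left_distributive amul +%R;
  amulDr : right_distributive amul +%R;
  amulZl : forall (k : K) (x y : A), amul (k *: x) y = k *: amul x y;
  amulZr : forall (k : K) (x y : A), amul x (k *: y) = k *: amul x y
}.

#[short(type="nonUnitalAlgType")]
HB.structure Definition NonUnitalAlgebra (K : comNzRingType) :=
  {A of GRing.Lmodule K A & Lmodule_isNonUnitalAlgebra K A}.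

HB.mixin Record NonUnitalAlgebra_isStarAlgebra (K : numClosedFieldType) A
    of NonUnitalAlgebra K A := {
  star : A -> A;
  starK : involutive star;
  starD : forall x y : A, star (x + y) = star x + star y;
  starZ : forall (k : K) (x : A), star (k *: x) = Num.conj k *: star x;
  starM : forall x y : A, star (amul x y) = amul (star y) (star x)
}.

#[short(type="starAlgType")]
HB.structure Definition StarAlgebra (K : numClosedFieldType) :=
  {A of NonUnitalAlgebra K A & NonUnitalAlgebra_isStarAlgebra K A}.

(* The norm of a normedModType R[i] takes its values in (the nonnegative real
   elements of) R[i]. *)
HB.mixin Record isCstarNorm (R : realType) A
    of StarAlgebra R[i] A & CompleteNormedModule R[i] A := {
  norm_amul : forall x y : A, `|amul x y| <= `|x| * `|y|;
  norm_amul_star : forall x : A, `|amul (star x) x| = `|x| ^+ 2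
}.

#[short(type="cstarAlgType")]
HB.structure Definition CstarAlgebra (R : realType) :=
  {A of StarAlgebra R[i] A & CompleteNormedModule R[i] A & isCstarNorm R A}.

(* The product a_1 a_2 ... a_n of a nonempty sequence; without a unit there is
   no empty product, and the value 0 on [::] is junk. *)
Definition aprod (K : comNzRingType) (A : nonUnitalAlgType K) (s : seq A) : A :=
  if s is a :: s' then foldl amul a s' else 0.

Definition n_homomorphism (K : comNzRingType) (A B : nonUnitalAlgType K)
    (n : nat) (phi : {linear A -> B}) : Prop :=
  forall a : n.-tuple A, phi (aprod a) = aprod (map phi a).

Definition involutive_map (K : numClosedFieldType) (A B : starAlgType K)
    (phi : A -> B) : Prop :=
  forall a : A, phi (star a) = star (phi a).

Definition bounded_operator (R : realType) (V W : normedModType R[i])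
    (phi : V -> W) : Prop :=
  exists M : R, forall v : V, `|phi v| <= M%:C * `|v|.

(* Valued in the extended reals, so that it is +oo (and not a default value)
   when phi is unbounded. *)
Definition operator_norm (R : realType) (V W : normedModType R[i])
    (phi : V -> W) : \bar R :=
  ereal_sup [set (complex.Re `|phi v|)%:E | v in [set v : V | `|v| <= 1]].

(* Main.v *)
(* The alternating word w(x) = x x* x x* ... of length n satisfies
   |w(x)| = |x|^n and phi (w(x)) = w(phi x).  Iterating w j times yields
   |phi x|^(n^j) <= M |x|^(n^j) for every j, where M bounds phi; letting j grow
   forces |phi x| <= 1 as soon as |x| <= 1. *)

Require Import Defs.
From HB Require Import structures.
From mathcomp Require Import all_boot all_order all_algebra.
From mathcomp Require Import complex.
From mathcomp Require Import all_classical all_reals all_analysis.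

Set Implicit Arguments.
Unset Strict Implicit.
Unset Printing Implicit Defensive.

Import Order.TTheory GRing.Theory Num.Theory.
Import numFieldNormedType.Exports.

Local Open Scope ring_scope.
Local Open Scope complex_scope.

(** The left-nested [foldl] is rebracketed by associativity. The tail must be nonempty, as [aprod
    [::]] is the junk value 0. *)
Lemma aprod_cons (K : comNzRingType) (A : nonUnitalAlgType K) (a : A) (s : seq A) :
  (0 < size s)%N -> aprod (a :: s) = amul a (aprod s).
Proof.
case: s => [//|b s] _ /=; elim: s b => [//|c s IHs] b /=.
by rewrite -amulA IHs.
Qed.

Lemma aprod_cat (K : comNzRingType) (A : nonUnitalAlgType K) (s t : seq A) :
  (0 < size s)%N -> (0 < size t)%N -> aprod (s ++ t) = amul (aprod s) (aprod t).
Proof.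
move=> s_gt0 t_gt0; elim: s s_gt0 => [//|a [|b s] IHs] _.
  by rewrite cat1s aprod_cons.
by rewrite cat_cons aprod_cons // IHs // amulA -(aprod_cons a).
Qed.

Section AlternatingWord.
Variables (K : numClosedFieldType) (A : starAlgType K).
Implicit Types (x : A) (k l : nat).

Fixpoint altseq x k : seq A :=
  if k is k'.+1 then x :: altseq (star x) k' else [::].

Definition altprod x k : A := aprod (altseq x k).

Lemma size_altseq x k : size (altseq x k) = k.
Proof. by elim: k x => //= k IHk x; rewrite IHk. Qed.

Lemma altseqD x k l :
  altseq x (k + l) = altseq x k ++ altseq (if odd k then star x else x) l.
Proof.
elim: k x => [//|k IHk] x; rewrite addSn /= IHk.
by case: (odd k); rewrite /= ?starK.
Qed.

Lemma altprodD x k l : (0 < k)%N -> (0 < l)%N ->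
  altprod x (k + l) = amul (altprod x k) (altprod (if odd k then star x else x) l).
Proof.
by move=> k_gt0 l_gt0; rewrite /altprod altseqD aprod_cat ?size_altseq.
Qed.

(** The star reverses the word and stars each letter, so the result starts with the starred last
    letter: [star x] for odd [k], [x] for even [k]. *)
Lemma star_altprod x k : (0 < k)%N ->
  star (altprod x k) = altprod (if odd k then star x else x) k.
Proof.
case: k => [//|k] _; elim: k x => [//|k IHk] x.
rewrite -[in LHS]add1n altprodD // starM IHk -[in RHS]addn1 altprodD // oddD /=.
by case: (odd k); rewrite /= ?starK.
Qed.

End AlternatingWord.

Section CstarNorm.
Variables (R : realType) (A : cstarAlgType R).
Implicit Type x : A.

(** The C*-identity gives |y|^2 = |y* y| <= |y*| |y|; cancel |y|, then apply this to both [x] and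
    [star x]. *)
Lemma norm_star x : `|star x| = `|x|.
Proof.
have le_norm_star (y : A) : `|y| <= `|star y|.
  have [->|y_neq0] := eqVneq y 0; first by rewrite normr0.
  rewrite -(ler_pM2r (_ : 0 < `|y|)) ?normr_gt0 // -expr2 -norm_amul_star.
  exact: norm_amul.
by apply/eqP; rewrite eq_le -{2}[x]starK !le_norm_star.
Qed.

Lemma norm_altprod x k : (0 < k)%N -> `|altprod x k| = `|x| ^+ k.
Proof.
have norm_le (y : A) l : (0 < l)%N -> `|altprod y l| <= `|y| ^+ l.
  case: l => [//|l] _; elim: l y => [//|l IHl] y.
  rewrite -add1n altprodD // exprD (le_trans (norm_amul _ _)) //.
  by rewrite ler_wpM2l // -(norm_star y) IHl.
(* Doubling the length of a word w gives w w*, whose norm is |w|^2 by the C*-identity. *)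
have norm_pow2 j (y : A) : `|altprod y (2 ^ j)| = `|y| ^+ (2 ^ j).
  elim: j => [//|j IHj].
  rewrite expnS mul2n -addnn altprodD ?expn_gt0 // -star_altprod ?expn_gt0 //.
  rewrite -{1}[altprod y (2 ^ j)]starK norm_amul_star norm_star IHj.
  by rewrite exprD expr2.
(* The case x = 0 is separate because a power of |x| is cancelled below. *)
move=> k_gt0; have [->|x_neq0] := eqVneq x 0.
  by apply/eqP; rewrite eq_le norm_le //= normr0 expr0n gtn_eqF ?normr_ge0.
apply/eqP; rewrite eq_le norm_le //=.
have k_lt : (k < 2 ^ k)%N by apply: ltn_expl.
have l_gt0 : (0 < 2 ^ k - k)%N by rewrite subn_gt0.
(* Submultiplicativity and the case of 2 ^ k force equality at k. *)
rewrite -(ler_pM2r (_ : 0 < `|x| ^+ (2 ^ k - k))) ?exprn_gt0 ?normr_gt0 //.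
rewrite -exprD subnKC ?(ltnW k_lt) // -norm_pow2.
rewrite -{1}(subnKC (ltnW k_lt)) altprodD // (le_trans (norm_amul _ _)) //.
rewrite ler_wpM2l // (le_trans (norm_le _ _ _)) //.
by case: (odd k); rewrite ?norm_star.
Qed.

End CstarNorm.

Lemma altprod_nhom (K : numClosedFieldType) (A B : starAlgType K) (n : nat)
    (phi : {linear A -> B}) :
  n_homomorphism n phi -> involutive_map phi ->
  forall x, phi (altprod x n) = altprod (phi x) n.
Proof.
move=> phi_nhom phi_star x.
have size_n : size (altseq x n) == n by rewrite size_altseq.
rewrite /altprod (phi_nhom (Tuple size_n)) /=; congr aprod.
by elim: n x {phi_nhom size_n} => //= n IHn x; rewrite IHn phi_star.
Qed.

(** If t > 1, Bernoulli's inequality gives t^(n^j) >= 1 + (t - 1) n^j, which is unbounded in j since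
    n^j > j. *)
Lemma le1_of_bounded_powers (R : realType) (t M : R) (n : nat) : (1 < n)%N ->
  (forall j, t ^+ (n ^ j) <= M) -> t <= 1.
Proof.
move=> n_gt1 t_le; rewrite leNgt; apply/negP => t_gt1.
have bernoulli m : 1 + (t - 1) *+ m <= t ^+ m.
  elim: m => [|m IHm]; first by rewrite mulr0n addr0 expr0.
  (* Write t^(m+1) = t^m (t - 1) + t^m and use t^m >= 1. *)
  rewrite mulrSr addrA exprSr -[leRHS](subrK (t ^+ m)) -{2}[t ^+ m]mulr1 -mulrBr.
  rewrite addrC lerD // ler_peMl ?subr_ge0 ?(ltW t_gt1) //.
  by rewrite exprn_ege1 // ltW.
have t1_gt0 : 0 < t - 1 by rewrite subr_gt0.
set j := Num.bound `|M / (t - 1)|.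
have M_lt : M < (t - 1) *+ j.
  rewrite -mulr_natl -ltr_pdivrMr //.
  by apply: le_lt_trans (ler_norm _) (archi_boundP _).
have : M < t ^+ (n ^ j).
  apply: (lt_le_trans M_lt); apply: le_trans (bernoulli _).
  by rewrite ler_wpDl // ler_pMn2l //; exact/ltnW/ltn_expl.
by rewrite ltNge t_le.
Qed.

Theorem theorem2p5 (R : realType) (n : nat) (hn : (2 <= n)%N)
  (A B : cstarAlgType R) (phi : {linear A -> B})
  (phi_nhom : n_homomorphism n phi) (phi_star : involutive_map phi)
  (phi_bounded : bounded_operator phi) :
  (operator_norm phi <= 1)%E.
Proof.
have n_gt0 : (0 < n)%N by apply: ltnW.
case: phi_bounded => M phi_le.
have norm_iter (C : cstarAlgType R) (x : C) j :
    `|iter j (fun y => altprod y n) x| = `|x| ^+ (n ^ j).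
  by elim: j => [//|j IHj]; rewrite iterS norm_altprod // IHj -exprM expnSr.
have phi_iter (x : A) j : phi (iter j (fun y => altprod y n) x)
    = iter j (fun y => altprod y n) (phi x).
  by elim: j => [//|j IHj]; rewrite !iterS (altprod_nhom phi_nhom) // IHj.
apply: ge_ereal_sup => _ [v v_le1 <-]; rewrite lee_fin.
apply: (@le1_of_bounded_powers _ _ `|M| n hn) => j.
(* The inequality is moved to [R[i]], where the norm is real and so equals its embedded real
   part. *)
rewrite -lecR rmorphXn /= RRe_real ?normr_real // -norm_iter -phi_iter.
apply: (le_trans (phi_le _)).
rewrite norm_iter; apply: (@le_trans _ _ (`|M|%:C * `|v| ^+ (n ^ j))).
  by rewrite ler_wpM2r ?exprn_ge0 // lecR ler_norm.
by rewrite ler_piMr ?lecR // exprn_ile1.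
Qed.
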